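(* Fix $n$, $T$, $A$, $\vec f$, the initial value $\vec u(0)$ and $\alpha$ as in the context, so that in particular, for all $t\in[0,T]$, $a_{ii}(t)>\sum_{j\ne i}|a_{ij}(t)|$ for $1\le i\le n$, $a_{ij}(t)\le 0$ for $i\neq j$, and $0<\alpha<\min_{t\in[0,T],\,1\le i\le n}\sum_{j=1}^n a_{ij}(t)$. Let $\vec u$ be the exact solution of $E\vec u'(t)+A(t)\vec u(t)=\vec f(t)$, $t\in(0,T]$, with $\vec u(0)$ given, and let $\vec U$ be the solution of the backward Euler scheme $E D^-\vec U(t_j)+A(t_j)\vec U(t_j)=\vec f(t_j)$, $1\le j\le N$, $\vec U(0)=\vec u(0)$, on the Shishkin mesh with $N$ mesh-intervals. Then there exists a constant $C$, independent of the singular perturbation parameters $\varepsilon_1,\dots,\varepsilon_n$ and of $N$, such that $$\|\vec U-\vec u\|\le C N^{-1}\ln N\qquad\text{for all } N>1,$$ where $\|\vec U-\vec u\|=\max_{0\le j\le N}\max_{1\le k\le n}|U_k(t_j)-u_k(t_j)|$.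
   Context: Problem: $n\ge 1$ is an integer, $T>0$, $A(t)=(a_{ij}(t))$ is an $n\times n$ matrix-valued function and $\vec f$ an $n$-vector-valued function on $[0,T]$, both continuously differentiable. $E=\mathrm{diag}(\varepsilon_1,\dots,\varepsilon_n)$, where the parameters satisfy $0<\varepsilon_1<\dots<\varepsilon_n\le 1$ and $T\ge 2\max_i(\varepsilon_i)/\alpha$. Mesh: $N$ is a positive integer divisible by $2^n$. Define transition points by $\sigma_n=\min\{T/2,\ (\varepsilon_n/\alpha)\ln N\}$ and $\sigma_i=\min\{\sigma_{i+1}/2,\ (\varepsilon_i/\alpha)\ln N\}$ for $i=n-1,\dots,1$. The Shishkin mesh $0=t_0<t_1<\dots<t_N=T$ is the piecewise uniform mesh obtained by placing a uniform mesh of $N/2^n$ mesh-intervals on $[0,\sigma_1]$, a uniform mesh of $N/2^{n-i+1}$ mesh-intervals on $(\sigma_i,\sigma_{i+1}]$ for $1\le i\le n-1$, and a uniform mesh of $N/2$ mesh-intervals on $(\sigma_n,T]$. Write $\delta_j=t_j-t_{j-1}$ and $D^-\vec U(t_j)=(\vec U(t_j)-\vec U(t_{j-1}))/\delta_j$. The constant $C$ may depend on $n,T,A,\vec f,\vec u(0),\alpha$, but not on $t$, $\varepsilon_1,\dots,\varepsilon_n$, or $N$. *)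

(* Defs.v *)
From HB Require Import structures.
From mathcomp Require Export all_boot all_order all_algebra.
From mathcomp Require Export all_classical all_reals all_analysis.
From mathcomp Require Import zify.
Set Implicit Arguments.
Unset Strict Implicit.
Unset Printing Implicit Defensive.
Import Order.TTheory GRing.Theory Num.Theory.
Import numFieldNormedType.Exports.
Local Open Scope classical_set_scope.
Local Open Scope ring_scope.

(** The derivative relative to [D]: one-sided at an endpoint of an interval. *)
Definition has_deriv_within (R : realType) (D : set R) (g : R -> R) (t l : R)
    : Prop :=
  (g s - g t) / (s - t) @[s --> within D t^'] --> l.

Definition C1_on (R : realType) (T : R) (g : R -> R) : Prop :=
  exists dg : R -> R,
    (forall t, t \in `[0, T] -> has_deriv_within `[0, T] g t (dg t)) /\
    {within `[0, T], continuous dg}.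

(** [eps] is a row vector only because [diag_mx] expects one; its entries
    are 0-indexed, [eps 0 i] standing for epsilon_{i+1}. *)
Definition is_ivp_solution (R : realType) (n : nat) (T : R) (eps : 'rV[R]_n)
    (A : R -> 'M[R]_n) (f : R -> 'cV[R]_n) (u0 : 'cV[R]_n) (u : R -> 'cV[R]_n)
    : Prop :=
  [/\ u 0 = u0,
      forall k, {within `[0, T], continuous (fun t => u t k 0)} &
      exists du : R -> 'cV[R]_n, forall t, t \in `]0, T] ->
        (forall k, has_deriv_within `[0, T] (fun s => u s k 0) t (du t k 0)) /\
        diag_mx eps *m du t + A t *m u t = f t].

(** [:: sigma_1; ...; sigma_n], computed from the last one backwards. Taking
    sigma_{n+1} = T makes the formula for sigma_n, with its T / 2, an instance
    of the general one. *)
Fixpoint transition_seq (R : realType) (T alpha : R) (N : nat) (eps : seq R)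
    : seq R :=
  if eps is e :: eps' then
    let s := transition_seq T alpha N eps' in
    Num.min (head T s / 2) (e / alpha * ln N%:R) :: s
  else [::].

(** sigma_k for 0 <= k <= n + 1, with sigma_0 = 0 and sigma_{n+1} = T. *)
Definition sigma (R : realType) (n : nat) (T alpha : R) (eps : 'rV[R]_n)
    (N k : nat) : R :=
  nth 0 (0 :: rcons (transition_seq T alpha N [seq eps 0 i | i : 'I_n]) T) k.

(** The number of mesh intervals between sigma_k and sigma_{k+1}, k <= n. *)
Definition piece_size (n N k : nat) : nat :=
  if k is 0 then N %/ 2 ^ n else N %/ 2 ^ (n - k + 1).

(** The points of the uniform mesh with [m] intervals on [[a, b]], except [a]. *)
Definition uniform_points (R : realType) (a b : R) (m : nat) : seq R :=
  [seq a + j%:R * ((b - a) / m%:R) | j <- iota 1 m].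

Definition shishkin_seq (R : realType) (n : nat) (T alpha : R) (eps : 'rV[R]_n)
    (N : nat) : seq R :=
  0 :: flatten [seq uniform_points (sigma T alpha eps N k)
                      (sigma T alpha eps N k.+1) (piece_size n N k)
               | k <- iota 0 n.+1].

Definition shishkin_mesh (R : realType) (n : nat) (T alpha : R)
    (eps : 'rV[R]_n) (N j : nat) : R :=
  nth 0 (shishkin_seq T alpha eps N) j.

Definition backward_difference (R : realType) (n : nat) (t : nat -> R)
    (U : nat -> 'cV[R]_n) (j : nat) : 'cV[R]_n :=
  (t j - t j.-1)^-1 *: (U j - U j.-1).

(** [U j] is the discrete solution at the mesh point [t j]. *)
Definition is_euler_solution (R : realType) (n : nat) (eps : 'rV[R]_n)
    (A : R -> 'M[R]_n) (f : R -> 'cV[R]_n) (u0 : 'cV[R]_n) (N : nat)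
    (t : nat -> R) (U : nat -> 'cV[R]_n) : Prop :=
  U 0%N = u0 /\
  forall j, (1 <= j <= N)%N ->
    diag_mx eps *m backward_difference t U j + A (t j) *m U j = f (t j).

(** The base value 0 of both maxima is harmless as all terms are nonnegative. *)
Definition mesh_error (R : realType) (n N : nat) (t : nat -> R)
    (U : nat -> 'cV[R]_n) (u : R -> 'cV[R]_n) : R :=
  \big[Num.max/0]_(j < N.+1) \big[Num.max/0]_(k < n)
    `|U j k 0 - u (t j) k 0|.

Lemma sigma0 (R : realType) (n : nat) (T alpha : R) (eps : 'rV[R]_n) (N : nat) :
  sigma T alpha eps N 0 = 0.
Proof. by []. Qed.

Lemma size_transition_seq (R : realType) (T alpha : R) (N : nat) (eps : seq R) :
  size (transition_seq T alpha N eps) = size eps.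
Proof. by elim: eps => //= e s ->. Qed.

Lemma sigma_last (R : realType) (n : nat) (T alpha : R) (eps : 'rV[R]_n)
    (N : nat) : sigma T alpha eps N n.+1 = T.
Proof.
rewrite /sigma /= nth_rcons size_transition_seq size_map -cardE card_ord.
by rewrite ltnn eqxx.
Qed.

Lemma sigma_rec (R : realType) (n : nat) (T alpha : R) (eps : 'rV[R]_n)
    (N : nat) (i : 'I_n) :
  sigma T alpha eps N i.+1 =
  Num.min (sigma T alpha eps N i.+2 / 2) (eps 0 i / alpha * ln N%:R).
Proof.
have nthE (s : seq R) k : (k < size s)%N ->
    nth 0 (rcons (transition_seq T alpha N s) T) k =
    Num.min (nth 0 (rcons (transition_seq T alpha N s) T) k.+1 / 2)
            (nth 0 s k / alpha * ln N%:R).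
  elim: s k => [|e s IHs] [|k] //= ks; last by rewrite IHs.
  by case: (transition_seq T alpha N s).
have szE : size [seq eps 0 i | i : 'I_n] = n by rewrite size_map -cardE card_ord.
rewrite /sigma /= nthE ?szE //; congr (Num.min _ (_ / _ * _)).
by rewrite (nth_map i) ?size_enum_ord // nth_ord_enum.
Qed.

Lemma size_shishkin_seq (R : realType) (n : nat) (T alpha : R) (eps : 'rV[R]_n)
    (N : nat) : (2 ^ n %| N)%N -> size (shishkin_seq T alpha eps N) = N.+1.
Proof.
move=> dN; rewrite /shishkin_seq -cat1s size_cat add1n size_flatten /shape -map_comp.
rewrite (eq_map (g := piece_size n N)); last first.
  by move=> k /=; rewrite size_map size_iota.
congr _.+1.
have partial m : (m <= n)%N ->
    (sumn [seq piece_size n N k | k <- iota 0 m.+1] = N %/ 2 ^ (n - m))%N.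
  elim: m => [|m IHm] mn; first by rewrite /= addn0 subn0.
  rewrite -[in iota _ _]addn1 iotaD map_cat sumn_cat IHm 1?ltnW //= addn0 add0n.
  rewrite addn1 -subSn // subSS -(subnSK mn).
  have d2 : (2 ^ (n - m.+1).+1 %| N)%N.
    by apply: dvdn_trans dN; rewrite dvdn_exp2l // subnSK // leq_subr.
  have /dvdnP[q ->] := d2.
  by rewrite mulnK ?expn_gt0 // expnS mulnCA mulnA mulnK ?expn_gt0 // mulnC; lia.
by rewrite partial // subnn divn1.
Qed.

(* Main.v *)
(** Since [E u' = f - A u], the truncation error of the scheme on a mesh interval
    is an increment of the flux [f - A u] over part of that interval, so only
    first derivatives of [u] have to be controlled. The vector [v = u'] solves
    [E v' + A v = f' - A' u] with initial values of size [O(1 / eps_i)], and the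
    comparison principle for M-matrices bounds it by [C (1 + psi)], where [psi]
    is an explicit supersolution dominated by a combination of the
    [exp (- alpha t / eps_q) / eps_q]. Integrating, each flux increment is at most
    a constant times the step plus the drops of the functions
    [exp (- alpha t / eps_q)], and on the Shishkin mesh every such drop is
    [O(ln N / N)]. Discrete stability turns this into the error estimate. *)

Require Import Defs.
From mathcomp Require Import ring lra zify.
Set Implicit Arguments.
Unset Strict Implicit.
Unset Printing Implicit Defensive.
Import Order.TTheory GRing.Theory Num.Theory.
Import numFieldNormedType.Exports.
Local Open Scope classical_set_scope.
Local Open Scope ring_scope.

(** * Calculus of derivatives relative to a set *)

Section within_derivative.
Variables (R : realType) (D : set R).
Implicit Types (g h : R -> R) (t l m : R).

Lemma has_deriv_within_continuous g t l : has_deriv_within D g t l ->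
  g s @[s --> within D (nbhs t)] --> g t.
Proof.
move=> gl.
have : g s @[s --> within D t^'] --> g t.
  have -> : g t = l * (t - t) + g t by rewrite subrr mulr0 add0r.
  apply: (@cvg_trans _ ((g s - g t) / (s - t) * (s - t) + g t @[s --> within D t^'])).
    apply: near_eq_cvg; rewrite near_withinE.
    near=> s => _; rewrite divfK ?subrK // subr_eq0.
    by near: s; exact: nbhs_dnbhs_neq.
  apply: cvgD; last exact: cvg_cst.
  apply: cvgM => //; apply: cvgB; last exact: cvg_cst.
  by apply: cvg_within_filter; apply: cvg_within_filter; exact: cvg_id.
(* The punctured limit extends to [t] itself, where the distance to [g t] is 0. *)
move=> /cvgrPdist_lt gc; apply/cvgrPdist_lt => e e0.
have := gc _ e0; rewrite /dnbhs !near_withinE => gn.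
near=> s => Ds; have [->|st] := eqVneq s t; first by rewrite subrr normr0.
by have := Ds; apply: (near gn s).
Unshelve. all: by end_near. Qed.

Lemma has_deriv_within_cst c t : has_deriv_within D (fun=> c) t 0.
Proof.
rewrite /has_deriv_within; under eq_fun do rewrite subrr mul0r.
exact: cvg_cst.
Qed.

Lemma has_deriv_withinD g h t l m :
  has_deriv_within D g t l -> has_deriv_within D h t m ->
  has_deriv_within D (fun s => g s + h s) t (l + m).
Proof.
move=> gl hm; rewrite /has_deriv_within.
under eq_fun do rewrite opprD addrACA mulrDl.
exact: cvgD.
Qed.

Lemma has_deriv_withinZ c g t l :
  has_deriv_within D g t l -> has_deriv_within D (fun s => c * g s) t (c * l).
Proof.
move=> gl; rewrite /has_deriv_within.
under eq_fun do rewrite -mulrBr -mulrA.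
by apply: cvgM => //; exact: cvg_cst.
Qed.

Lemma has_deriv_withinB g h t l m :
  has_deriv_within D g t l -> has_deriv_within D h t m ->
  has_deriv_within D (fun s => g s - h s) t (l - m).
Proof.
move=> gl hm; rewrite /has_deriv_within.
under eq_fun do rewrite opprD addrACA -opprD mulrDl mulNr.
exact: cvgB.
Qed.

Lemma has_deriv_withinM g h t l m :
  has_deriv_within D g t l -> has_deriv_within D h t m ->
  has_deriv_within D (fun s => g s * h s) t (l * h t + g t * m).
Proof.
move=> gl hm; rewrite /has_deriv_within.
have gc : g s @[s --> within D t^'] --> g t.
  apply: (@cvg_trans _ (g s @[s --> within D (nbhs t)])); last first.
    exact: has_deriv_within_continuous gl.
  by apply: cvg_app => P; rewrite /within /=; exact: nbhs_dnbhs.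
suff -> : (fun s => (g s * h s - g t * h t) / (s - t)) =
    (fun s => (g s - g t) / (s - t) * h t + g s * ((h s - h t) / (s - t))).
  apply: cvgD; apply: cvgM => //; exact: cvg_cst.
apply/funext => s; ring.
Qed.

Lemma has_deriv_within_sum (I : Type) (r : seq I) (P : pred I)
    (g : I -> R -> R) t (l : I -> R) :
  (forall i, P i -> has_deriv_within D (g i) t (l i)) ->
  has_deriv_within D (fun s => \sum_(i <- r | P i) g i s) t
    (\sum_(i <- r | P i) l i).
Proof.
move=> gl; elim: r => [|i r IH].
  by under eq_fun do rewrite big_nil; rewrite big_nil; exact: has_deriv_within_cst.
under eq_fun do rewrite big_cons; rewrite big_cons.
by case: ifP => // Pi; apply: has_deriv_withinD => //; exact: gl.
Qed.

End within_derivative.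

(** The substitution [s = t + h] turns increments tending to 0 into points tending to [t]. This
    links relative derivatives to the mean value theorem and to the derivatives of exponentials. *)
Lemma is_deriveP (R : realType) (g : R -> R) (t l : R) :
  is_derive t (1 : R) g l <-> (g s - g t) / (s - t) @[s --> t^'] --> l.
Proof.
have qE : h^-1 *: ((g \o shift t) (h *: (1 : R)) - g t) @[h --> 0^'] --> l <->
    (g s - g t) / (s - t) @[s --> t^'] --> l.
  split => /cvgrPdist_lt gl; apply/cvgrPdist_lt => e e0; move/gl: e0;
      rewrite /dnbhs !near_withinE.
    rewrite [X in X -> _](near_shift t); apply: filterS => s /=.
    rewrite sub0r subr_eq0 [_%:A]mulr1 subrK => P st.
    by have := P st; rewrite [_ *: _]mulrC.
  rewrite [X in X -> _](@near_shift _ R 0); apply: filterS => h /=.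
  rewrite subr0 => P h0; have := P; rewrite [_%:A]mulr1 addrK [_ *: _]mulrC; apply.
  by rewrite -subr_eq0 addrK.
split => [[gd gl]|/qE gl].
  by apply/qE; rewrite -gl; exact: gd.
by split; [apply/cvg_ex; exists l|exact: cvg_lim].
Qed.

Lemma is_derive_has_deriv_within (R : realType) (D : set R) (g : R -> R)
    (t l : R) :
  is_derive t (1 : R) g l -> has_deriv_within D g t l.
Proof. by move=> /is_deriveP gl; exact: cvg_within_filter. Qed.

(** Near an interior point the restriction to [[a, b]] removes nothing. *)
Lemma has_deriv_within_is_derive (R : realType) (a b : R) (g : R -> R)
    (t l : R) :
  t \in `]a, b[ -> has_deriv_within `[a, b] g t l -> is_derive t (1 : R) g l.
Proof.
move=> tab gl; apply/is_deriveP; apply: cvg_trans gl.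
apply: cvg_app => P; rewrite /within /=.
have : \forall s \near t, s \in `]a, b[ by exact: near_in_itvoo.
move=> nt nP; change (\forall s \near t, s != t -> P s).
have {}nP : \forall s \near t, s != t -> s \in `[a, b] -> P s.
  exact: nP.
near=> s => st; have : s \in `[a, b].
  by apply: subset_itv_oo_cc; near: s.
by apply: (near nP s).
Unshelve. all: by end_near. Qed.

(* Only the left difference quotients are used, so [t = b] is allowed. *)
Lemma has_deriv_within_argmin (R : realType) (a b : R) (g : R -> R) (t l : R) :
  t \in `]a, b] -> has_deriv_within `[a, b] g t l ->
  (forall s, s \in `[a, b] -> g t <= g s) -> l <= 0.
Proof.
rewrite in_itv /= => /andP[at_ tb] gl gt.
have {}gl : (g s - g t) / (s - t) @[s --> t^'-] --> l.
  apply: cvg_trans gl; apply: cvg_app => P nP.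
  change (\forall s \near t, s < t -> P s).
  have {}nP : \forall s \near t, s != t -> s \in `[a, b] -> P s.
    exact: nP.
  have na : \forall s \near t, s < t -> a < s := nbhs_left_gt at_.
  near=> s => st.
  have as_ : a < s by apply: (near na s).
  apply: (near nP s) => //; first by rewrite lt_eqF.
  by rewrite in_itv /= !ltW // (lt_le_trans st).
apply: (cvgr_to_le gl).
near=> s.
have st : s < t by near: s; exact: nbhs_left_lt.
have as_ : a < s by near: s; exact: nbhs_left_gt.
rewrite mulr_ge0_le0 //; last by rewrite invr_le0 subr_le0 ltW.
by rewrite subr_ge0 gt // in_itv /= !ltW // (lt_le_trans st).
Unshelve. all: by end_near. Qed.

(** * Comparison principle *)

Lemma continuous_itv_bounded (R : realType) (I : finType) (a b : R)
    (g : I -> R -> R) :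
  a <= b -> (forall i, {within `[a, b], continuous g i}) ->
  exists2 M, 0 < M & forall i t, t \in `[a, b] -> `|g i t| <= M.
Proof.
move=> ab gc.
have /choice[M gM] (i : I) : exists M, forall t, t \in `[a, b] -> `|g i t| <= M.
  have [c1 _ c1P] := EVT_max ab (gc i); have [c2 _ c2P] := EVT_min ab (gc i).
  exists (`|g i c1| + `|g i c2|) => t tab; have := c1P _ tab; have := c2P _ tab.
  have := ler_norm (g i c1); have := ler_norm (- g i c2); rewrite normrN.
  have := normr_ge0 (g i c1); have := normr_ge0 (g i c2).
  by rewrite ler_norml => *; apply/andP; split; lra.
(* The summand 1 keeps the bound positive even for an empty family. *)
exists (1 + \sum_i `|M i|); first by rewrite ltr_wpDr // sumr_ge0.
move=> i t tab; apply: (le_trans (gM i t tab)); apply: (le_trans (ler_norm _)).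
by rewrite (bigD1 i) //= addrCA lerDl addr_ge0 // sumr_ge0.
Qed.

(** Each function attains a positive minimum, and finiteness of [I] gives a common bound. This turns
    the strict inequality between [alpha] and the row sums into a gap uniform in [t]. *)
Lemma continuous_itv_gt0 (R : realType) (I : finType) (a b : R)
    (g : I -> R -> R) :
  a <= b -> (forall i, {within `[a, b], continuous g i}) ->
  (forall i t, t \in `[a, b] -> 0 < g i t) ->
  exists2 m, 0 < m & forall i t, t \in `[a, b] -> m <= g i t.
Proof.
move=> ab gc g0.
have /choice[m gm] (i : I) :
    exists m, 0 < m /\ forall t, t \in `[a, b] -> m <= g i t.
  by have [c cab cP] := EVT_min ab (gc i); exists (g i c); split => //; exact: g0.
exists (\big[Num.min/1]_i m i).
  by apply: lt_bigmin => // i _; case: (gm i).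
by move=> i t tab; apply: bigmin_inf => //; case: (gm i) => _; exact.
Qed.

(** Derivatives are asked for on []a, b]] because the equation for [u] is posed on []0, T]]. *)
Lemma is_derive_mean_value (R : realType) (a b s t : R) (g dg : R -> R) :
  {within `[a, b], continuous g} ->
  (forall r, r \in `]a, b] -> has_deriv_within `[a, b] g r (dg r)) ->
  a <= s -> s < t -> t <= b ->
  exists2 r, r \in `]s, t[ & g t - g s = dg r * (t - s).
Proof.
move=> gc gd as_ st tb; apply: MVT => //.
  move=> r; rewrite in_itv /= => /andP[sr rt].
  apply: (@has_deriv_within_is_derive _ a b).
    by rewrite in_itv /= (le_lt_trans as_ sr) (lt_le_trans rt tb).
  by apply: gd; rewrite in_itv /= (le_lt_trans as_ sr) (le_trans (ltW rt) tb).
apply: continuous_subspaceW gc => r /=; rewrite !in_itv /= => /andP[sr rt].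
by rewrite (le_trans as_ sr) (le_trans rt tb).
Qed.

(** At a negative minimum over all components and times the derivative is nonpositive, and the row
    of [A] applied to [w] is at most its positive sum times that minimum. The operator would then be
    negative there. *)
Lemma comparison_principle (R : realType) (n : nat) (T : R) (e : 'I_n -> R)
    (A : R -> 'M[R]_n) (w dw : 'I_n -> R -> R) :
  0 <= T -> (forall i, 0 <= e i) ->
  (forall t i j, t \in `[0, T] -> i != j -> A t i j <= 0) ->
  (forall t i, t \in `[0, T] -> 0 < \sum_j A t i j) ->
  (forall i, {within `[0, T], continuous w i}) ->
  (forall i t, t \in `]0, T] -> has_deriv_within `[0, T] (w i) t (dw i t)) ->
  (forall i t, t \in `]0, T] -> 0 <= e i * dw i t + \sum_j A t i j * w j t) ->
  (forall i, 0 <= w i 0) ->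
  forall i t, t \in `[0, T] -> 0 <= w i t.
Proof.
move=> T0 e0 Aoff Asum wc wd wL w0 i t tT; rewrite leNgt; apply/negP => wit.
have /choice[m wm] (j : 'I_n) :
    exists m, m \in `[0, T] /\ forall s, s \in `[0, T] -> w j m <= w j s.
  by have [c ? ?] := EVT_min T0 (wc j); exists c.
(* The component with the least minimum, so that [w j (m j)] is minimal over all components and
   times. *)
have [j _ jmin] := @arg_minP _ _ _ i xpredT (fun j => w j (m j)) isT.
have [mT mP] := wm j.
have wj0 : w j (m j) < 0.
  by apply: le_lt_trans wit; apply: (le_trans (jmin i isT)); case: (wm i) => _; exact.
have mT' : m j \in `]0, T].
  move: mT; rewrite !in_itv /= => /andP[m0 ->]; rewrite andbT lt_neqAle m0 andbT.
  by apply/eqP => m0'; move: wj0; rewrite -m0' ltNge w0.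
have dle := has_deriv_within_argmin mT' (wd _ _ mT') mP.
have : e j * dw j (m j) + \sum_k A (m j) j k * w k (m j) < 0.
  rewrite ltr_wnDl ?mulr_ge0_le0 //.
  apply: (@le_lt_trans _ _ ((\sum_k A (m j) j k) * w j (m j))); last first.
    by rewrite pmulr_rlt0 // Asum.
  (* Replacing [w k (m j)] by the smaller [w j (m j)] can only raise an off-diagonal term, whose
     coefficient is nonpositive. *)
  rewrite mulr_suml; apply: ler_sum => k _; have [->//|kj] := eqVneq j k.
  rewrite ler_wnM2l ?Aoff //; apply: (le_trans (jmin k isT)).
  by case: (wm k) => _; exact.
by rewrite ltNge wL.
Qed.

(** The comparison principle for [phi + w] and for [phi - w] gives the two sides of the absolute
    value. *)
Lemma comparison_principle_norm (R : realType) (n : nat) (T : R)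
    (e : 'I_n -> R) (A : R -> 'M[R]_n) (w dw phi dphi : 'I_n -> R -> R) :
  0 <= T -> (forall i, 0 <= e i) ->
  (forall t i j, t \in `[0, T] -> i != j -> A t i j <= 0) ->
  (forall t i, t \in `[0, T] -> 0 < \sum_j A t i j) ->
  (forall i, {within `[0, T], continuous w i}) ->
  (forall i, {within `[0, T], continuous phi i}) ->
  (forall i t, t \in `]0, T] -> has_deriv_within `[0, T] (w i) t (dw i t)) ->
  (forall i t, t \in `]0, T] -> has_deriv_within `[0, T] (phi i) t (dphi i t)) ->
  (forall i t, t \in `]0, T] ->
    `|e i * dw i t + \sum_j A t i j * w j t| <=
    e i * dphi i t + \sum_j A t i j * phi j t) ->
  (forall i, `|w i 0| <= phi i 0) ->
  forall i t, t \in `[0, T] -> `|w i t| <= phi i t.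
Proof.
move=> T0 e0 Aoff Asum wc pc wd pd wp wp0 i t tT.
rewrite ler_norml; apply/andP; split.
  rewrite lerNl -subr_ge0 opprK.
  apply: (comparison_principle (w := fun i t => phi i t + w i t)
    (dw := fun i t => dphi i t + dw i t) T0 e0 Aoff Asum _ _ _ _ i tT)
    => {i t tT} [i x|i t tT|i t tT|i].
  - by apply: cvgD; [exact: pc|exact: wc].
  - by apply: has_deriv_withinD; [exact: pd|exact: wd].
  - under eq_bigr do rewrite mulrDr; rewrite big_split mulrDr addrACA /=.
    by have := wp i t tT; rewrite ler_norml => /andP[+ _]; lra.
  - by have := wp0 i; rewrite ler_norml => /andP[+ _]; lra.
rewrite -subr_ge0.
apply: (comparison_principle (w := fun i t => phi i t - w i t)
  (dw := fun i t => dphi i t - dw i t) T0 e0 Aoff Asum _ _ _ _ i tT)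
    => {i t tT} [i x|i t tT|i t tT|i].
- by apply: cvgB; [exact: pc|exact: wc].
- by apply: has_deriv_withinB; [exact: pd|exact: wd].
- under eq_bigr do rewrite mulrBr; rewrite big_split sumrN mulrBr addrACA /=.
  by have := wp i t tT; rewrite ler_norml => /andP[_]; lra.
- by have := wp0 i; rewrite ler_norml => /andP[_]; lra.
Qed.

(** * Boundary layers and the supersolution *)

Section layers.
Variables (R : realType) (n : nat) (alpha : R) (eps : 'I_n -> R).
Hypothesis alpha_gt0 : 0 < alpha.
Hypothesis eps_gt0 : forall i, 0 < eps i.
Hypothesis eps_ndec : forall i j : 'I_n, (i <= j)%N -> eps i <= eps j.

Definition layer (q : 'I_n) (t : R) : R := expR (- (alpha / eps q * t)).

Lemma layer_gt0 q t : 0 < layer q t.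
Proof. exact: expR_gt0. Qed.

Lemma layer0 q : layer q 0 = 1.
Proof. by rewrite /layer mulr0 oppr0 expR0. Qed.

Lemma layer_nincr q s t : s <= t -> layer q t <= layer q s.
Proof. by move=> st; rewrite ler_expR lerN2 ler_wpM2l // divr_ge0 ?ltW. Qed.

Lemma layer_le (q i : 'I_n) t : 0 <= t -> (q <= i)%N -> layer q t <= layer i t.
Proof.
move=> t0 /eps_ndec qi; rewrite ler_expR lerN2 ler_wpM2r //.
by rewrite ler_pM2l // lef_pV2 ?posrE.
Qed.

(** By the exponential law the drop is [layer q s * (1 - layer q (t - s))], and [1 + x <= expR x]
    bounds the second factor. This serves where the mesh is fine relative to [eps q]. *)
Lemma layer_sub_le q s t :
  0 <= s -> s <= t -> layer q s - layer q t <= alpha / eps q * (t - s).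
Proof.
move=> s0 st.
have -> : layer q t = layer q s * layer q (t - s).
  by rewrite -expRD; congr expR; ring.
have -> : layer q s - layer q s * layer q (t - s) =
    layer q s * (1 - layer q (t - s)) by ring.
have le1 : layer q s <= 1 by rewrite -(layer0 q) layer_nincr.
have ge : 1 - alpha / eps q * (t - s) <= layer q (t - s) by exact: expR_ge1Dx.
have le1' : layer q (t - s) <= 1 by rewrite -(layer0 q) layer_nincr ?subr_ge0.
apply: (@le_trans _ _ (1 - layer q (t - s))); last lra.
by rewrite ler_piMl // subr_ge0.
Qed.

Lemma is_derive_layer q (t : R) :
  is_derive t (1 : R) (layer q) (- (alpha / eps q) * layer q t).
Proof.
have lin : is_derive t (1 : R) (fun s => - (alpha / eps q * s)) (- (alpha / eps q)).
  by apply: is_derive_eq; rewrite ?scaler0 ?addr0 [_ *: _]mulr1.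
by apply: is_derive_eq; rewrite [LHS]mulrC.
Qed.

Variables (am gamma M : R).
Hypothesis am_gt0 : 0 < am.
Hypothesis gamma_gt0 : 0 < gamma.
Hypothesis M_ge1 : 1 <= M.
Hypothesis M_am : am / alpha <= M - 1.
Hypothesis M_gamma : am ^+ 2 / alpha <= gamma * (M - 1).

(* The correction for [q < i] compensates the forcing of the slower component
   [i] by the layer of width [eps q] in the faster components. *)
Definition layer_weight (q i : 'I_n) : R :=
  if (i <= q)%N then M ^+ q / eps q else - (am / alpha * M ^+ q / eps i).

(** The supersolution for [u']. The weights carry powers of [M] so that the layer of index [i]
    dominates the corrections due to the faster layers [q < i]. *)
Definition barrier (i : 'I_n) (t : R) : R :=
  \sum_q layer_weight q i * layer q t.

Definition dbarrier (i : 'I_n) (t : R) : R :=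
  \sum_q layer_weight q i * (- (alpha / eps q) * layer q t).

Let Mq_ge0 q : 0 <= M ^+ q. Proof. by rewrite exprn_ge0 // (le_trans ler01). Qed.

Lemma layer_weight_le q i : layer_weight q i <= M ^+ q / eps q.
Proof.
rewrite /layer_weight; case: ifP => // _; apply: (@le_trans _ _ 0).
  by rewrite oppr_le0 !mulr_ge0 // ?invr_ge0 ltW.
by rewrite divr_ge0 // ltW.
Qed.

Lemma barrier_le i t : barrier i t <= \sum_(q < n) M ^+ q / eps q * layer q t.
Proof.
by apply: ler_sum => q _; rewrite ler_wpM2r ?layer_weight_le // ltW ?layer_gt0.
Qed.

Lemma sum_expr_lt (i : 'I_n) :
  (M - 1) * \sum_(q < n | (q < i)%N) M ^+ q = M ^+ i - 1.
Proof.
by rewrite -(big_ord_widen n (fun q : nat => M ^+ q)) ?subrX1 // ltnW.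
Qed.

(** The own layer contributes [M ^+ i / eps i] and the slower ones a nonnegative amount. By [M_am]
    and the geometric sum, the faster ones take away at most [(M ^+ i - 1) / eps i]. *)
Lemma barrier0_ge i : (eps i)^-1 <= barrier i 0.
Proof.
apply: (@le_trans _ _ (\sum_q ((if q == i then M ^+ i / eps i else 0) +
    (if (q < i)%N then - (am / alpha / eps i) * M ^+ q else 0)))).
  rewrite big_split /= -!big_mkcond big_pred1_eq -mulr_sumr.
  have S0 : 0 <= \sum_(q < n | (q < i)%N) M ^+ q by exact: sumr_ge0.
  have := ler_wpM2r S0 M_am; rewrite sum_expr_lt => SM.
  rewrite mulNr.
  set S := \sum_(_ < _ | _) _ in SM *.
  have -> : M ^+ i / eps i - am / alpha / eps i * S =
    (M ^+ i - am / alpha * S) / eps i by field; rewrite !gt_eqF.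
  by rewrite -[leLHS]mul1r ler_pM2r ?invr_gt0 //; lra.
apply: ler_sum => q _; rewrite layer0 mulr1 /layer_weight.
case: ltngtP => [qi|iq|/val_inj ->].
- by rewrite -val_eqE ltn_eqF //= add0r le_eqVlt; apply/orP; left; apply/eqP; ring.
- by rewrite -val_eqE gtn_eqF //= add0r divr_ge0 // ltW.
- by rewrite eqxx addr0.
Qed.

(** The operator is expanded in the layers. For [q >= i] the row sum exceeds the decay rate [alpha]
    by [gamma], leaving a positive coefficient. For [q < i] the correction cancels the coupling of
    order [1 / eps q] and leaves a remainder of order [1 / eps i]. By [M_gamma] the surplus at
    [q = i] absorbs all these remainders. *)
Lemma barrier_supersolution (a : 'I_n -> R) (i : 'I_n) t :
  0 <= t -> (forall j, i != j -> a j <= 0) -> a i <= am ->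
  alpha + gamma <= \sum_j a j ->
  0 <= eps i * dbarrier i t + \sum_j a j * barrier j t.
Proof.
move=> t0 aoff ai asum.
(* The coefficient of [layer q t] in the operator applied to the barrier. *)
pose X q := - (alpha * eps i / eps q) * layer_weight q i
            + \sum_j a j * layer_weight q j.
have -> : eps i * dbarrier i t + \sum_j a j * barrier j t =
    \sum_q X q * layer q t.
  rewrite /dbarrier mulr_sumr.
  under [X in _ + X]eq_bigr do rewrite mulr_sumr.
  rewrite exchange_big -big_split /=; apply: eq_bigr => q _.
  rewrite mulrDl mulr_suml; congr (_ + _); last by apply: eq_bigr => j _; ring.
  by field; rewrite gt_eqF.
(* Termwise lower bound: the surplus at [q = i], a remainder for each [q < i] with [layer q t]
   enlarged to [layer i t], and 0 for [q > i]. *)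
apply: (@le_trans _ _ (\sum_q (
    (if q == i then gamma * M ^+ i / eps i * layer i t else 0) +
    (if (q < i)%N then - (am ^+ 2 / alpha / eps i * layer i t) * M ^+ q
     else 0)))).
  rewrite big_split /= -!big_mkcond big_pred1_eq -mulr_sumr.
  have S0 : 0 <= \sum_(q < n | (q < i)%N) M ^+ q by exact: sumr_ge0.
  have SM := ler_wpM2r S0 M_gamma.
  have {}SM : am ^+ 2 / alpha * \sum_(q < n | (q < i)%N) M ^+ q <=
      gamma * (M ^+ i - 1) by rewrite -sum_expr_lt mulrA.
  set S := \sum_(_ < _ | _) _ in SM *.
  have -> : gamma * M ^+ i / eps i * layer i t
      + - (am ^+ 2 / alpha / eps i * layer i t) * S =
      (gamma * M ^+ i - am ^+ 2 / alpha * S) * (layer i t / eps i).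
    by field; rewrite !gt_eqF.
  rewrite mulr_ge0 ?divr_ge0 ?(ltW (layer_gt0 _ _)) ?(ltW (eps_gt0 _)) //.
  by rewrite subr_ge0 (le_trans SM) // ler_pM2l // gerBl.
have asumE : \sum_j a j = a i + \sum_(j | j != i) a j by rewrite (bigD1 i).
rewrite asumE in asum; have aoff_sum : - am <= \sum_(j | j != i) a j.
  by have := alpha_gt0; have := gamma_gt0; lra.
(* Off-diagonal entries are nonpositive, so an upper bound on the weights suffices. *)
have off_ge (q : 'I_n) : \sum_(j | j != i) a j * (M ^+ q / eps q) <=
    \sum_(j | j != i) a j * layer_weight q j.
  apply: ler_sum => j ji; rewrite ler_wnM2l ?layer_weight_le //.
  by rewrite aoff // eq_sym.
apply: ler_sum => q _; have [qi|iq] := ltnP q i.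
  rewrite -val_eqE ltn_eqF //= add0r.
  rewrite -mulNr -mulrAC.
  apply: (@le_trans _ _ (- (am ^+ 2 / alpha / eps i) * M ^+ q * layer q t)).
    rewrite !mulNr lerN2 ler_wpM2l ?layer_le // 1?ltnW //.
    by rewrite !mulr_ge0 ?invr_ge0 // ?exprn_ge0 // ltW.
  rewrite ler_wpM2r ?(ltW (layer_gt0 _ _)) //.
  rewrite /X (bigD1 i) //= {1 2}/layer_weight leqNgt qi /=.
  have := off_ge q; rewrite -mulr_suml => offq.
  have := ler_wpM2r (divr_ge0 (Mq_ge0 q) (ltW (eps_gt0 q))) aoff_sum => offq'.
  have d_ge0 : 0 <= am / alpha * M ^+ q / eps i.
    apply: divr_ge0; last exact: ltW.
    by apply: mulr_ge0 => //; apply: divr_ge0; exact: ltW.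
  have aiq := ler_wpM2r d_ge0 ai.
  (* Differentiating the correction produces exactly the term that offsets [offq']. Only its product
     with the diagonal entry remains. *)
  have -> : - (alpha * eps i / eps q) * - (am / alpha * M ^+ q / eps i) =
    am * (M ^+ q / eps q) by field; rewrite !gt_eqF.
  have E : am * (am / alpha * M ^+ q / eps i) = am ^+ 2 / alpha / eps i * M ^+ q.
    by ring.
  rewrite mulNr -E mulrN; lra.
have Xge : gamma * (M ^+ q / eps q) <= X q.
  rewrite /X (bigD1 i) //= {1 2}/layer_weight iq.
  have := off_ge q; rewrite -mulr_suml => offq.
  have m0 : 0 <= M ^+ q / eps q by rewrite divr_ge0 // ltW.
  have r1 : alpha * eps i / eps q <= alpha.
    by rewrite ler_pdivrMr // ler_pM2l // eps_ndec.
  have := ler_wpM2r m0 r1; have := ler_wpM2r m0 asum; lra.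
have [qi|qi] := eqVneq q i.
  subst q; rewrite addr0 -[gamma * _ / _]mulrA ler_wpM2r //.
  exact: ltW (layer_gt0 _ _).
rewrite addr0 mulr_ge0 ?(ltW (layer_gt0 _ _)) //.
by apply: le_trans Xge; rewrite mulr_ge0 ?divr_ge0 // ltW.
Qed.
End layers.

(** * Flux increments and truncation error *)

Lemma has_deriv_within_itv_continuous (R : realType) (a b : R) (g dg : R -> R) :
  (forall t, t \in `[a, b] -> has_deriv_within `[a, b] g t (dg t)) ->
  {within `[a, b], continuous g}.
Proof.
move=> gd; apply/subspace_continuousP => t tab.
exact: has_deriv_within_continuous (gd t tab).
Qed.

(** The mean value theorem for [phi - g] and [phi + g] replaces integration of the bound on [dg]. *)
Lemma norm_increment_le (R : realType) (a b s t : R) (g dg phi dphi : R -> R) :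
  {within `[a, b], continuous g} -> {within `[a, b], continuous phi} ->
  (forall r, r \in `]a, b] -> has_deriv_within `[a, b] g r (dg r)) ->
  (forall r, r \in `]a, b] -> has_deriv_within `[a, b] phi r (dphi r)) ->
  (forall r, r \in `]a, b] -> `|dg r| <= dphi r) ->
  a <= s -> s <= t -> t <= b -> `|g t - g s| <= phi t - phi s.
Proof.
move=> gc pc gd pd gp as_; rewrite le_eqVlt => /predU1P[->|st] tb.
  by rewrite !subrr normr0.
have sub r : r \in `]s, t[ -> r \in `]a, b].
  rewrite !in_itv /= => /andP[sr rt].
  by rewrite (le_lt_trans as_ sr) (le_trans (ltW rt) tb).
have [r /sub rab rE] := is_derive_mean_value
  (g := fun x => phi x - g x) (dg := fun x => dphi x - dg x)
  (fun x => cvgB (pc x) (gc x))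
  (fun x xab => has_deriv_withinB (pd x xab) (gd x xab)) as_ st tb.
have [r' /sub rab' rE'] := is_derive_mean_value
  (g := fun x => phi x + g x) (dg := fun x => dphi x + dg x)
  (fun x => cvgD (pc x) (gc x))
  (fun x xab => has_deriv_withinD (pd x xab) (gd x xab)) as_ st tb.
have ts : 0 <= t - s by rewrite subr_ge0 ltW.
have := gp _ rab; have := gp _ rab'; rewrite !ler_norml => /andP[r1 _] /andP[_ r2].
have P1 : 0 <= (dphi r - dg r) * (t - s) by rewrite mulr_ge0 // subr_ge0.
have P2 : 0 <= (dphi r' + dg r') * (t - s).
  by rewrite mulr_ge0 // -[dg r']opprK subr_ge0 lerNl.
by apply/andP; split; lra.
Qed.

(** * A priori bounds for the solution, its derivative and its flux *)

Section system.
Variables (R : realType) (n : nat) (T alpha : R).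
Variables (A dA : R -> 'M[R]_n) (f df : R -> 'cV[R]_n).
Hypothesis T_gt0 : 0 < T.
Hypothesis A_deriv : forall i j t, t \in `[0, T] ->
  has_deriv_within `[0, T] (fun s => A s i j) t (dA t i j).
Hypothesis f_deriv : forall i t, t \in `[0, T] ->
  has_deriv_within `[0, T] (fun s => f s i 0) t (df t i 0).
Hypothesis A_offdiag : forall (t : R) (i j : 'I_n), t \in `[0, T] ->
  i != j -> A t i j <= 0.
Hypothesis alpha_gt0 : 0 < alpha.
Variables (gamma F F1 a a1 : R).
Hypothesis gamma_gt0 : 0 < gamma.
Hypothesis A_sum : forall (t : R) (i : 'I_n), t \in `[0, T] ->
  alpha + gamma <= \sum_(j < n) A t i j.
Hypothesis f_le : forall i t, t \in `[0, T] -> `|f t i 0| <= F.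
Hypothesis df_le : forall i t, t \in `[0, T] -> `|df t i 0| <= F1.
Hypothesis A_le : forall i j t, t \in `[0, T] -> `|A t i j| <= a.
Hypothesis dA_le : forall i j t, t \in `[0, T] -> `|dA t i j| <= a1.
Hypothesis a_gt0 : 0 < a.
Hypothesis F_ge0 : 0 <= F.
Hypothesis F1_ge0 : 0 <= F1.
Hypothesis a1_ge0 : 0 <= a1.

Variables (eps : 'rV[R]_n) (u0 : 'cV[R]_n) (u du : R -> 'cV[R]_n).
Hypothesis eps_gt0 : forall i, 0 < eps 0 i.
Hypothesis eps_ndec : forall i j : 'I_n, (i <= j)%N -> eps 0 i <= eps 0 j.
Hypothesis u_0 : u 0 = u0.
Hypothesis u_continuous : forall k, {within `[0, T], continuous (fun t => u t k 0)}.
Hypothesis u_deriv : forall k t, t \in `]0, T] ->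
  has_deriv_within `[0, T] (fun s => u s k 0) t (du t k 0).
Hypothesis u_eq : forall i t, t \in `]0, T] ->
  eps 0 i * du t i 0 + \sum_j A t i j * u t j 0 = f t i 0.

Let sumA_gt0 t i : t \in `[0, T] -> 0 < \sum_(j < n) A t i j.
Proof. by move=> tT; apply: lt_le_trans (A_sum i tT); rewrite addr_gt0. Qed.

Let subT t : t \in `]0, T] -> t \in `[0, T].
Proof. by rewrite !in_itv /= => /andP[/ltW -> ->]. Qed.

(** A constant supersolution: [F / alpha] dominates the source and the sum dominates the initial
    value. Like the later constants it involves neither [eps] nor [N]. *)
Definition solution_bound := F / alpha + \sum_i `|u0 i 0|.

Lemma solution_bound_ge0 : 0 <= solution_bound.
Proof. by rewrite addr_ge0 ?sumr_ge0 // divr_ge0 // ltW. Qed.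

Lemma solution_le i t : t \in `[0, T] -> `|u t i 0| <= solution_bound.
Proof.
have K0 := solution_bound_ge0.
apply: (comparison_principle_norm (e := fun i => eps 0 i) (A := A)
  (w := fun i t => u t i 0) (dw := fun i t => du t i 0)
  (phi := fun _ _ => solution_bound) (dphi := fun _ _ => 0)) => //.
- exact: ltW.
- by move=> j; apply: ltW.
- by move=> j x; exact: cvg_cst.
- by move=> j s _; exact: has_deriv_within_cst.
- move=> j s sT; rewrite u_eq // mulr0 add0r -mulr_suml.
  apply: (le_trans (f_le _ (subT sT))).
  apply: (@le_trans _ _ (alpha * solution_bound)).
    by rewrite mulrDr mulrCA mulfV ?gt_eqF // mulr1 lerDl mulr_ge0 ?sumr_ge0 ?ltW.
  by rewrite ler_wpM2r //; apply: le_trans (A_sum _ (subT sT)); rewrite lerDl ltW.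
- move=> j; rewrite u_0 /solution_bound (bigD1 j) //= addrCA lerDl.
  by rewrite addr_ge0 ?sumr_ge0 // divr_ge0 // ltW.
Qed.

(* The flux [E u'], continued to [t = 0] by means of the equation. *)
Definition flux i t := f t i 0 - \sum_j A t i j * u t j 0.

Definition dflux i t :=
  df t i 0 - \sum_j (dA t i j * u t j 0 + A t i j * du t j 0).

Lemma flux_du i t : t \in `]0, T] -> flux i t = eps 0 i * du t i 0.
Proof. by move=> tT; rewrite /flux -(u_eq i tT) addrK. Qed.

Lemma flux_continuous i : {within `[0, T], continuous (flux i)}.
Proof.
move=> x; apply: cvgB.
  exact: (has_deriv_within_itv_continuous (@f_deriv i)).
apply: cvg_big => [|j _]; first exact: add_continuous.
apply: cvgM; last exact: u_continuous.
exact: (has_deriv_within_itv_continuous (@A_deriv i j)).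
Qed.

Lemma flux_deriv i t : t \in `]0, T] ->
  has_deriv_within `[0, T] (flux i) t (dflux i t).
Proof.
move=> tT; apply: has_deriv_withinB; first exact: f_deriv (subT tT).
apply: has_deriv_within_sum => j _; apply: has_deriv_withinM.
  exact: A_deriv (subT tT).
exact: u_deriv.
Qed.

Definition flux_bound := F + n%:R * (a * solution_bound).
(** Bounds [f' - A' u], the right-hand side of the system solved by [u']. *)
Definition forcing_bound := F1 + n%:R * (a1 * solution_bound).

Lemma norm_sum_const (g : 'I_n -> R) c :
  (forall j, `|g j| <= c) -> `|\sum_j g j| <= n%:R * c.
Proof.
move=> gc; apply: (le_trans (ler_norm_sum _ _ _)).
rewrite mulr_natl -[X in _ *+ X]card_ord -sumr_const.
by apply: ler_sum => j _; exact: gc.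
Qed.

Lemma flux_le i t : t \in `[0, T] -> `|flux i t| <= flux_bound.
Proof.
move=> tT; apply: (le_trans (ler_normB _ _)); rewrite lerD ?f_le //.
apply: norm_sum_const => j; rewrite normrM ler_pM //; first exact: A_le.
exact: solution_le.
Qed.

Lemma forcing_le i t : t \in `[0, T] ->
  `|df t i 0 - \sum_j dA t i j * u t j 0| <= forcing_bound.
Proof.
move=> tT; apply: (le_trans (ler_normB _ _)); rewrite lerD ?df_le //.
apply: norm_sum_const => j; rewrite normrM ler_pM //; first exact: dA_le.
exact: solution_le.
Qed.

(** The value chosen for [M]: the second summand secures [M_am], the third [M_gamma]. *)
Definition weight_base := 1 + a / alpha + a ^+ 2 / alpha / gamma.
(** The first summand handles the initial value of [u'], of size [flux_bound / eps], the second its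
    forcing. *)
Definition du_bound := flux_bound + forcing_bound / alpha.

Local Notation Layer := (layer alpha (fun q => eps 0 q)).
Local Notation Barrier := (barrier alpha (fun q => eps 0 q) a weight_base).

Lemma flux_bound_ge0 : 0 <= flux_bound.
Proof. by rewrite addr_ge0 ?mulr_ge0 ?solution_bound_ge0 // ltW. Qed.

Lemma forcing_bound_ge0 : 0 <= forcing_bound.
Proof. by rewrite addr_ge0 ?mulr_ge0 ?solution_bound_ge0. Qed.

Lemma du_bound_ge0 : 0 <= du_bound.
Proof.
by rewrite addr_ge0 ?flux_bound_ge0 // divr_ge0 ?forcing_bound_ge0 // ltW.
Qed.

Lemma weight_base_ge1 : 1 <= weight_base.
Proof.
have ? := ltW alpha_gt0; have ? := ltW gamma_gt0; have ? := ltW a_gt0.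
by rewrite /weight_base -addrA lerDl addr_ge0 ?divr_ge0 ?exprn_ge0.
Qed.

Lemma weight_base_alpha : a / alpha <= weight_base - 1.
Proof.
have a2 : 0 <= a ^+ 2 / alpha / gamma by rewrite !divr_ge0 ?exprn_ge0 // ltW.
by rewrite /weight_base; lra.
Qed.

Lemma weight_base_gamma : a ^+ 2 / alpha <= gamma * (weight_base - 1).
Proof.
have -> : gamma * (weight_base - 1) = gamma * (a / alpha) + a ^+ 2 / alpha.
  by rewrite /weight_base; field; rewrite !gt_eqF.
by rewrite lerDr mulr_ge0 ?divr_ge0 // ltW.
Qed.

Lemma barrier_deriv i t : has_deriv_within `[0, T] (Barrier i) t
  (dbarrier alpha (fun q => eps 0 q) a weight_base i t).
Proof.
apply: has_deriv_within_sum => q _; apply: has_deriv_withinZ.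
exact: is_derive_has_deriv_within (is_derive_layer _ _ _ _).
Qed.

(** The comparison is made for [flux / eps]. It agrees with [u'] on []0, T]], is continuous up to 0,
    and is differentiable on []0, T]] although no second derivative of [u] is assumed. *)
Lemma du_le i t : t \in `]0, T] ->
  `|du t i 0| <= du_bound * (1 + Barrier i t).
Proof.
move=> tT; have K0 := du_bound_ge0.
have -> : du t i 0 = flux i t / eps 0 i.
  by rewrite flux_du // mulrAC mulfV ?mul1r // gt_eqF.
have phi_deriv j s : has_deriv_within `[0, T]
    (fun s => du_bound * (1 + Barrier j s)) s
    (du_bound * (0 + dbarrier alpha (fun q => eps 0 q) a weight_base j s)).
  apply: has_deriv_withinZ; apply: has_deriv_withinD; last exact: barrier_deriv.
  exact: has_deriv_within_cst.
apply: (comparison_principle_norm (T := T) (e := fun i => eps 0 i) (A := A)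
  (w := fun i t => flux i t / eps 0 i) (dw := fun i t => dflux i t / eps 0 i)
  (phi := fun i t => du_bound * (1 + Barrier i t))
  (dphi := fun i t => du_bound *
    (0 + dbarrier alpha (fun q => eps 0 q) a weight_base i t))) => //.
- exact: ltW.
- by move=> j; apply: ltW.
- by move=> j x; apply: cvgM; [exact: flux_continuous|exact: cvg_cst].
- by move=> j; apply: has_deriv_within_itv_continuous => s _; exact: phi_deriv.
- move=> j s sT /=.
  have -> : (fun t => flux j t / eps 0 j) = (fun t => (eps 0 j)^-1 * flux j t).
    by apply/funext => r; rewrite mulrC.
  rewrite [dflux j s / _]mulrC.
  exact: has_deriv_withinZ (@flux_deriv j s sT).
- move=> j s sT.
  (* The terms with [A u'] cancel, leaving the forcing [f' - A' u]. *)
  have -> : eps 0 j * (dflux j s / eps 0 j)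
      + \sum_k A s j k * (flux k s / eps 0 k) =
      df s j 0 - \sum_k dA s j k * u s k 0.
    have -> : \sum_k A s j k * (flux k s / eps 0 k) = \sum_k A s j k * du s k 0.
      by apply: eq_bigr => k _; rewrite flux_du // mulrAC mulfV ?mul1r // gt_eqF.
    by rewrite mulrCA mulfV ?gt_eqF // mulr1 /dflux big_split /=; ring.
  apply: (le_trans (forcing_le j (subT sT))).
  have SB : 0 <= eps 0 j * dbarrier alpha (fun q => eps 0 q) a weight_base j s
      + \sum_k A s j k * Barrier k s.
    apply: (barrier_supersolution alpha_gt0 eps_gt0 eps_ndec a_gt0 gamma_gt0).
    - exact: weight_base_ge1.
    - exact: weight_base_gamma.
    - by move: sT; rewrite in_itv /= => /andP[/ltW].
    - by move=> k; apply: A_offdiag; exact: subT.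
    - by apply: (le_trans (ler_norm _)); apply: A_le; exact: subT.
    - by apply: A_sum; exact: subT.
  rewrite add0r; under eq_bigr do rewrite mulrCA mulrDr mulr1.
  rewrite -mulr_sumr big_split /= mulrCA -mulrDr addrCA.
  (* The barrier contributes a nonnegative amount, so the constant 1 alone, multiplied by the row
     sum, has to dominate the forcing. *)
  apply: (@le_trans _ _ (du_bound * alpha)).
    rewrite mulrDl divfK ?gt_eqF // lerDr mulr_ge0 ?flux_bound_ge0 //.
    exact: ltW.
  rewrite ler_wpM2l //; apply: (@le_trans _ _ (alpha + 0)); first by rewrite addr0.
  by rewrite lerD //; apply: le_trans (A_sum _ (subT sT)); rewrite lerDl ltW.
- move=> j; rewrite normrM [ `|_^-1|]gtr0_norm ?invr_gt0 //.
  have T0 : 0 \in `[0, T] by rewrite in_itv /= lexx ltW.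
  have B0 : (eps 0 j)^-1 <= 1 + Barrier j 0.
    rewrite ler_wpDl //.
    exact: (barrier0_ge alpha_gt0 eps_gt0 weight_base_ge1 weight_base_alpha).
  apply: ler_pM => //; first by rewrite invr_ge0 ltW.
  apply: (le_trans (flux_le j T0)); rewrite lerDl divr_ge0 ?forcing_bound_ge0 //.
  exact: ltW.
- exact: subT.
Qed.

Definition flux_rate :=
  (forcing_bound + n%:R * (a * du_bound)) * (1 + weight_base ^+ n / alpha).

Lemma flux_rate_ge0 : 0 <= flux_rate.
Proof.
have ? : 0 <= weight_base by apply: le_trans weight_base_ge1.
have ? := ltW alpha_gt0; have ? := ltW a_gt0.
apply: mulr_ge0; last by rewrite addr_ge0 // divr_ge0 // exprn_ge0.
by rewrite addr_ge0 ?forcing_bound_ge0 // !mulr_ge0 // du_bound_ge0.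
Qed.

(** The factor [alpha / eps 0 q] makes each summand the exact negative derivative of a layer, ready
    for integration. The powers of [weight_base] are absorbed into [flux_rate]. *)
Lemma dflux_le i t : t \in `]0, T] ->
  `|dflux i t| <= flux_rate * (1 + \sum_q alpha / eps 0 q * Layer q t).
Proof.
move=> tT; set S := \sum_q _.
have S0 : 0 <= S.
  apply: sumr_ge0 => q _; rewrite mulr_ge0 ?divr_ge0 //; [exact: ltW..|].
  exact: ltW (layer_gt0 _ _ _ _).
have M1 := weight_base_ge1; have M0 : 0 <= weight_base by apply: le_trans M1.
have du_le' j : `|du t j 0| <= du_bound * (1 + weight_base ^+ n / alpha * S).
  apply: (le_trans (du_le j tT)); rewrite ler_wpM2l ?du_bound_ge0 // lerD2l.
  apply: (le_trans (barrier_le alpha_gt0 eps_gt0 a_gt0 M1 _ _)).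
  rewrite mulr_sumr; apply: ler_sum => q _.
  rewrite mulrA ler_wpM2r ?(ltW (layer_gt0 _ _ _ _)) //.
  rewrite [leRHS]mulrA divfK ?gt_eqF // ler_pM2r ?invr_gt0 //.
  by rewrite ler_weXn2l // ltnW.
have -> : dflux i t = (df t i 0 - \sum_j dA t i j * u t j 0)
    - \sum_j A t i j * du t j 0 by rewrite /dflux big_split /=; ring.
apply: (le_trans (ler_normB _ _)).
apply: (@le_trans _ _ (forcing_bound
    + n%:R * (a * (du_bound * (1 + weight_base ^+ n / alpha * S))))).
  rewrite lerD ?forcing_le ?subT //; apply: norm_sum_const => j.
  by rewrite normrM ler_pM //; exact: A_le (subT tT).
have c0 : 0 <= weight_base ^+ n / alpha by rewrite divr_ge0 ?exprn_ge0 // ltW.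
set c := weight_base ^+ n / alpha in c0 *.
rewrite /flux_rate -/c; have := forcing_bound_ge0.
have : 0 <= n%:R * (a * du_bound) by rewrite !mulr_ge0 ?du_bound_ge0 // ltW.
set P := n%:R * (a * du_bound) => P0 f0.
have -> : n%:R * (a * (du_bound * (1 + c * S))) = P * (1 + c * S) by rewrite /P; ring.
apply: (@le_trans _ _ ((forcing_bound + P) * (1 + c * S))).
  by rewrite [leRHS]mulrDl lerD2r ler_peMr // lerDl mulr_ge0.
rewrite -[leRHS]mulrA ler_wpM2l ?(addr_ge0 f0 P0) //.
have -> : (1 + c) * (1 + S) = 1 + c * S + (S + c) by ring.
by rewrite lerDl addr_ge0.
Qed.

Lemma flux_increment_le i s t : 0 <= s -> s <= t -> t <= T ->
  `|flux i t - flux i s| <=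
  flux_rate * (t - s + \sum_q (Layer q s - Layer q t)).
Proof.
(* A primitive of the bound on [dflux]. *)
pose phi r := flux_rate * (r - \sum_q Layer q r).
pose dphi r := flux_rate * (1 - \sum_q - (alpha / eps 0 q) * Layer q r).
have phi_deriv r : has_deriv_within `[0, T] phi r (dphi r).
  apply: has_deriv_withinZ; apply: has_deriv_withinB.
    by apply: is_derive_has_deriv_within; exact: is_derive_id.
  apply: has_deriv_within_sum => q _.
  exact: is_derive_has_deriv_within (is_derive_layer _ _ _ _).
move=> s0 st tT.
have -> : flux_rate * (t - s + \sum_q (Layer q s - Layer q t)) = phi t - phi s.
  by rewrite /phi sumrB; ring.
apply: (norm_increment_le (a := 0) (b := T) (dg := dflux i) (dphi := dphi)) => //.
- exact: flux_continuous.
- by apply: has_deriv_within_itv_continuous => r _; exact: phi_deriv.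
- by move=> r; exact: flux_deriv.
- move=> r rT; apply: (le_trans (dflux_le i rT)).
  rewrite /dphi; under [X in _ <= _ * (1 - X)]eq_bigr do rewrite mulNr.
  by rewrite sumrN opprK.
Qed.

(** The backward quotient equals [u'] at an intermediate point [r], so its multiple by [eps] is the
    flux at [r], while the equation at [t] involves the flux at [t]. *)
Lemma truncation_error_le i s t : 0 <= s -> s < t -> t <= T ->
  `|eps 0 i * ((t - s)^-1 * (u t i 0 - u s i 0)) + \sum_j A t i j * u t j 0
    - f t i 0| <= flux_rate * (t - s + \sum_q (Layer q s - Layer q t)).
Proof.
move=> s0 st tT.
have [r rst rE] := is_derive_mean_value (g := fun t => u t i 0)
  (dg := fun t => du t i 0) (@u_continuous i) (@u_deriv i) s0 st tT.
move: rst; rewrite in_itv /= => /andP[sr rt].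
have r0 : 0 <= r := le_trans s0 (ltW sr).
have -> : eps 0 i * ((t - s)^-1 * (u t i 0 - u s i 0)) = flux i r.
  rewrite rE [_^-1 * _]mulrC mulfK ?subr_eq0 ?gt_eqF // flux_du //.
  by rewrite in_itv /= (le_lt_trans s0 sr) (ltW (lt_le_trans rt tT)).
have -> : flux i r + \sum_j A t i j * u t j 0 - f t i 0 = - (flux i t - flux i r).
  by rewrite [flux i t]/flux; ring.
rewrite normrN; apply: (le_trans (flux_increment_le i r0 (ltW rt) tT)).
(* Extending [[r, t]] to [[s, t]] increases both the length and the layer drops. *)
rewrite ler_wpM2l ?flux_rate_ge0 // lerD ?lerD2l ?lerN2 ?(ltW sr) //.
by apply: ler_sum => q _; rewrite lerD2r layer_nincr // ltW.
Qed.

End system.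

(** * The Shishkin mesh *)

Section mesh.
Variables (R : realType) (n : nat) (T alpha : R) (eps : 'rV[R]_n) (N : nat).
Hypothesis T_gt0 : 0 < T.
Hypothesis alpha_gt0 : 0 < alpha.
Hypothesis eps_gt0 : forall i, 0 < eps 0 i.
Hypothesis eps_ndec : forall i j : 'I_n, (i <= j)%N -> eps 0 i <= eps 0 j.
Hypothesis N_gt1 : (1 < N)%N.
Hypothesis N_dvd : (2 ^ n %| N)%N.

Local Notation sg := (sigma T alpha eps N).
Local Notation t_ := (shishkin_mesh T alpha eps N).
Local Notation Layer := (layer alpha (fun q => eps 0 q)).

Let lnN_gt0 : 0 < ln (N%:R : R). Proof. by rewrite ln_gt0 // ltr1n. Qed.

Let width_gt0 i : 0 < eps 0 i / alpha * ln N%:R.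
Proof. by rewrite mulr_gt0 ?divr_gt0. Qed.

(** Induction runs downwards from [sigma_{n+1} = T], as in the recursion for the transition
    points. *)
Lemma sigma_gt0 k : (k <= n)%N -> 0 < sg k.+1.
Proof.
move=> kn; rewrite -(subKn kn); elim: (n - k)%N (leq_subr k n) => [|m IHm] mn.
  by rewrite subn0 sigma_last.
have i_lt : (n - m.+1 < n)%N by lia.
rewrite -[(n - m.+1)%N]/(val (Ordinal i_lt)) sigma_rec /= lt_min width_gt0 andbT.
by rewrite subnSK // divr_gt0 // IHm // ltnW.
Qed.

Lemma sigma_le_half k : (k <= n)%N -> sg k <= sg k.+1 / 2.
Proof.
case: k => [|k] kn; first by rewrite sigma0 divr_ge0 // ltW // sigma_gt0.
by rewrite -[k]/(val (Ordinal kn)) sigma_rec ge_min lexx.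
Qed.

Lemma sigma_lt k : (k <= n)%N -> sg k < sg k.+1.
Proof. by move=> kn; have := sigma_le_half kn; have := sigma_gt0 kn; lra. Qed.

Lemma sigma_ge0 k : (k <= n.+1)%N -> 0 <= sg k.
Proof. by case: k => [|k] kn; rewrite ?sigma0 // ltW // sigma_gt0. Qed.

Lemma sigma_le_T k : (k <= n.+1)%N -> sg k <= T.
Proof.
move=> kn; rewrite -(subKn kn); elim: (n.+1 - k)%N (leq_subr k n.+1) => [|m IHm] mn.
  by rewrite subn0 sigma_last.
apply: le_trans (IHm (ltnW mn)); rewrite subSS subSn //.
by apply: ltW; apply: sigma_lt; rewrite leq_subr.
Qed.

(* On a mesh piece, either the layer of width [eps q] is already below [1 / N],
   or the mesh size is at most a multiple of [eps q * ln N / N]. *)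
Lemma sigma_dichotomy (q : 'I_n) k : (k <= n)%N ->
  eps 0 q / alpha * ln N%:R <= sg k \/
  sg k.+1 <= 2 * (eps 0 q / alpha * ln N%:R).
Proof.
move=> kn; set L := _ * _; have L0 : 0 < L by exact: width_gt0.
have L_le (i j : 'I_n) : (i <= j)%N ->
    eps 0 i / alpha * ln N%:R <= eps 0 j / alpha * ln N%:R.
  by move=> ij; rewrite ler_pM2r // ler_pM2r ?invr_gt0 // eps_ndec.
(* With 0-indexed [eps], the point [sg k.+1] is capped by the width for [eps 0 k], which is at most
   [L] when [k <= q]. *)
have [kq|qk] := leqP k q.
  right; have k_lt : (k < n)%N by apply: leq_ltn_trans kq _.
  rewrite -[k]/(val (Ordinal k_lt)) sigma_rec.
  apply: (@le_trans _ _ L); last by rewrite ler_peMl ?ler1n // ltW.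
  by rewrite ge_min L_le ?orbT.
case: k kn qk => [|k] kn // qk; have := sigma_rec T alpha eps N (Ordinal kn).
rewrite /= => kE; have := L_le q (Ordinal kn) qk; rewrite -/L => Lk.
have [|skL] := leP L (sg k.+1); [by left|right].
(* The width for [Ordinal kn] is at least [L]. If the transition point lies below [L], the minimum
   is therefore half the next point, which is then below [2 * L]. *)
by move: kE skL; rewrite /Num.min; case: ifP => _ ->; lra.
Qed.

(** A relation between neighbours, so that [path] can carry it through the concatenation of the
    pieces. *)
Definition mesh_step (x y : R) : Prop :=
  exists2 k, (k <= n)%N &
    [/\ sg k <= x, y <= sg k.+1 & y - x = (sg k.+1 - sg k) / (piece_size n N k)%:R].

Lemma piece_size_ge k : (k <= n)%N -> (N %/ 2 ^ n <= piece_size n N k)%N.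
Proof.
by case: k => [|k] kn //=; rewrite leq_div2l ?expn_gt0 // leq_pexp2l //; lia.
Qed.

Lemma divN_gt0 : (0 < N %/ 2 ^ n)%N.
Proof. by rewrite divn_gt0 ?expn_gt0 // dvdn_leq // ltnW. Qed.

Lemma piece_size_gt0 k : (k <= n)%N -> (0 < piece_size n N k)%N.
Proof. by move=> /piece_size_ge; apply: leq_trans; exact: divN_gt0. Qed.

(** The second conjunct is what chains the pieces: each ends where the next one starts. *)
Lemma path_uniform_points k : (k <= n)%N ->
  path (fun x y => `[< mesh_step x y >]) (sg k)
    (uniform_points (sg k) (sg k.+1) (piece_size n N k)) /\
  last (sg k) (uniform_points (sg k) (sg k.+1) (piece_size n N k)) = sg k.+1.
Proof.
move=> kn; have m0 := piece_size_gt0 kn; set m := piece_size n N k in m0 *.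
pose h := (sg k.+1 - sg k) / m%:R.
have m_neq0 : m%:R != 0 :> R by rewrite pnatr_eq0 -lt0n.
have h0 : 0 <= h by rewrite divr_ge0 // subr_ge0 ltW // sigma_lt.
have hE : sg k.+1 = sg k + m%:R * h by rewrite /h mulrC divfK // addrC subrK.
have main l i : (i + l <= m)%N ->
    path (fun x y => `[< mesh_step x y >]) (sg k + i%:R * h)
      [seq sg k + j%:R * h | j <- iota i.+1 l] /\
    last (sg k + i%:R * h) [seq sg k + j%:R * h | j <- iota i.+1 l] =
      sg k + (i + l)%:R * h.
  elim: l i => [|l IHl] i il /=; first by rewrite addn0.
  have [|pP lP] := IHl i.+1; first by rewrite addSnnS.
  rewrite pP lP addSnnS; split=> //; rewrite andbT; apply/asboolP; exists k => //.
  split; first by rewrite lerDl mulr_ge0.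
    by rewrite hE lerD2l ler_wpM2r // ler_nat; lia.
  by rewrite -/m -/h -natr1; ring.
have [] := main m 0%N (leqnn _); rewrite mul0r addr0 add0n => pP lP.
by split; [exact: pP|rewrite [RHS]hE; exact: lP].
Qed.

Lemma path_shishkin :
  path (fun x y => `[< mesh_step x y >]) 0
    (behead (shishkin_seq T alpha eps N)).
Proof.
suff main l i : (i + l <= n.+1)%N ->
    path (fun x y => `[< mesh_step x y >]) (sg i)
      (flatten [seq uniform_points (sg k) (sg k.+1) (piece_size n N k)
               | k <- iota i l]) by exact: (main n.+1 0%N).
elim: l i => [|l IHl] i il //.
have /path_uniform_points[pP lP] : (i <= n)%N by lia.
by rewrite [iota _ _]/= map_cons [flatten _]/= cat_path pP lP /= IHl // addSnnS.
Qed.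

Lemma mesh_stepP j : (j < N)%N -> mesh_step (t_ j) (t_ j.+1).
Proof.
move=> jN; have /(pathP 0) /(_ j) := path_shishkin.
rewrite size_behead size_shishkin_seq // => /(_ jN) /asboolP.
by rewrite nth_behead.
Qed.

(** Every piece has at least [N / 2 ^ n] intervals. The step is bounded through the right end
    [sg k.+1], the quantity that the dichotomy controls. *)
Lemma mesh_interval j : (j < N)%N ->
  exists2 k, (k <= n)%N &
    [/\ sg k <= t_ j, t_ j < t_ j.+1, t_ j.+1 <= sg k.+1 &
       t_ j.+1 - t_ j <= 2 ^+ n * sg k.+1 / N%:R].
Proof.
move=> /mesh_stepP[k kn [k1 k2 hE]]; exists k => //.
have [m0 d0] := (piece_size_gt0 kn, divN_gt0).
have sg0 : 0 <= sg k by apply: sigma_ge0; lia.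
have h0 : 0 < t_ j.+1 - t_ j.
  by rewrite hE divr_gt0 ?ltr0n // subr_gt0 sigma_lt.
split=> //; first by rewrite -subr_gt0.
have NE : N%:R = (N %/ 2 ^ n)%:R * 2 ^+ n :> R.
  by rewrite -natrX -natrM divnK.
have -> : 2 ^+ n * sg k.+1 / N%:R = sg k.+1 / (N %/ 2 ^ n)%:R.
  by rewrite NE; field; rewrite pnatr_eq0 -lt0n d0 expf_neq0.
rewrite hE; apply: ler_pM.
- by rewrite subr_ge0 ltW // sigma_lt.
- by rewrite invr_ge0.
- by rewrite gerBl.
- by rewrite lef_pV2 ?posrE ?ltr0n // ler_nat piece_size_ge.
Qed.

Lemma mesh_ge0 j : (j < N)%N -> 0 <= t_ j.
Proof.
move=> /mesh_interval[k kn [k1 _ _ _]].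
by apply: le_trans k1; apply: sigma_ge0; lia.
Qed.

Lemma mesh_lt j : (j < N)%N -> t_ j < t_ j.+1.
Proof. by move=> /mesh_interval[k _ []]. Qed.

Lemma mesh_le_T j : (j < N)%N -> t_ j.+1 <= T.
Proof.
by move=> /mesh_interval[k kn [_ _ k2 _]]; apply: (le_trans k2); apply: sigma_le_T.
Qed.

Let N_gt0 : 0 < N%:R :> R. Proof. by rewrite ltr0n ltnW. Qed.

Lemma mesh_width_le j : (j < N)%N -> t_ j.+1 - t_ j <= 2 ^+ n * T * N%:R^-1.
Proof.
move=> /mesh_interval[k kn [_ _ _ /le_trans]]; apply.
by rewrite ler_pM2r ?invr_gt0 // ler_pM2l ?exprn_gt0 // sigma_le_T.
Qed.

Lemma layer_drop_le q j : (j < N)%N ->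
  Layer q (t_ j) - Layer q (t_ j.+1) <= (1 + 2 ^+ n.+1 * ln N%:R) * N%:R^-1.
Proof.
move=> jN; have [k kn [k1 k12 k2 hle]] := mesh_interval jN.
have lnN0 := lnN_gt0; have N0 := N_gt0; have e0 := eps_gt0 q; have a0 := alpha_gt0.
have [L_le|le_L] := sigma_dichotomy q kn.
  (* The layer has already decayed: its value at the left end, at most [1 / N], bounds the drop. *)
  apply: (@le_trans _ _ (Layer q (t_ j))); first by rewrite gerBl ltW // layer_gt0.
  apply: (@le_trans _ _ (Layer q (eps 0 q / alpha * ln N%:R))).
    by apply: layer_nincr => //; exact: le_trans L_le k1.
  rewrite /layer; have -> : alpha / eps 0 q * (eps 0 q / alpha * ln N%:R) = ln N%:R.
    by field; rewrite !gt_eqF.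
  rewrite expRN lnK ?posrE // mulrDl mul1r lerDl.
  by rewrite !mulr_ge0 ?exprn_ge0 ?invr_ge0 // ltW.
(* The mesh resolves the layer: in the Lipschitz bound the factor [eps 0 q] of the step cancels the
   slope [alpha / eps 0 q]. *)
apply: (le_trans (layer_sub_le _ _ _ (mesh_ge0 jN) (ltW k12))) => //.
apply: (@le_trans _ _ (2 ^+ n.+1 * ln N%:R * N%:R^-1)); last first.
  by rewrite ler_pM2r ?invr_gt0 // lerDr.
apply: (@le_trans _ _ (alpha / eps 0 q *
    (2 ^+ n * (2 * (eps 0 q / alpha * ln N%:R)) / N%:R))).
  rewrite ler_pM2l ?divr_gt0 //; apply: (le_trans hle).
  by rewrite ler_pM2r ?invr_gt0 // ler_pM2l ?exprn_gt0.
by rewrite le_eqVlt exprS; apply/orP; left; apply/eqP; field; rewrite !gt_eqF.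
Qed.

End mesh.

(** * Discrete stability and the final estimate *)

(** Induction on the time level. If the largest component exceeded [M / alpha], it would exceed all
    values of the previous level. Its signed difference quotient would be nonnegative, and the row
    sums would force a residual larger than [M]. *)
Lemma euler_stability (R : realType) (n N : nat) (alpha M : R) (eps : 'I_n -> R)
    (t : nat -> R) (B : nat -> 'M[R]_n) (e : nat -> 'I_n -> R) :
  0 < alpha -> 0 <= M -> (forall i, 0 <= eps i) ->
  (forall j, (j < N)%N -> t j < t j.+1) ->
  (forall j i k, (j < N)%N -> i != k -> B j.+1 i k <= 0) ->
  (forall j i, (j < N)%N -> alpha <= \sum_k B j.+1 i k) ->
  (forall i, e 0%N i = 0) ->
  (forall j i, (j < N)%N ->
    `|eps i * ((t j.+1 - t j)^-1 * (e j.+1 i - e j i))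
      + \sum_k B j.+1 i k * e j.+1 k| <= M) ->
  forall j i, (j <= N)%N -> `|e j i| <= M / alpha.
Proof.
move=> a0 M0 eps0 tlt Boff Bsum e0 eM; elim=> [|j IHj] i jN.
  by rewrite e0 normr0 divr_ge0 // ltW.
have [i1 _ i1max] := @arg_maxP _ _ _ i xpredT (fun i => `|e j.+1 i|) isT.
apply: (le_trans (i1max i isT)); set m := `|e j.+1 i1|.
rewrite leNgt; apply/negP => mM.
have Mm : M < alpha * m by rewrite mulrC -ltr_pdivrMr.
suff : alpha * m <= M by rewrite leNgt Mm.
apply: le_trans (eM _ i1 jN).
(* Multiplying by the sign of the extremal component treats positive and negative extrema
   together. *)
pose s := Num.sg (e j.+1 i1).
have sE : s * e j.+1 i1 = m by rewrite /s -normrEsg.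
have s1 : `|s| <= 1 by rewrite normr_sg lern1 leq_b1.
set X := _ + _; apply: (@le_trans _ _ (s * X)); last first.
  apply: (le_trans (ler_norm _)); rewrite normrM.
  by rewrite ler_piMl.
rewrite /X mulrDr mulr_sumr.
have sle k : s * e j.+1 k <= m.
  apply: (le_trans (ler_norm _)); rewrite normrM.
  by apply: (le_trans _ (i1max k isT)); rewrite ler_piMl.
have D0 : 0 <= s * (eps i1 * ((t j.+1 - t j)^-1 * (e j.+1 i1 - e j i1))).
  have -> : s * (eps i1 * ((t j.+1 - t j)^-1 * (e j.+1 i1 - e j i1))) =
      eps i1 * (t j.+1 - t j)^-1 * (s * e j.+1 i1 - s * e j i1) by ring.
  rewrite mulr_ge0 ?mulr_ge0 ?invr_ge0 ?subr_ge0 ?(ltW (tlt _ jN)) // sE.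
  apply: (le_trans (ler_norm _)); rewrite normrM.
  apply: (@le_trans _ _ `|e j i1|); first by rewrite ler_piMl.
  by apply: (le_trans (IHj i1 (ltnW jN))); exact: ltW.
apply: (@le_trans _ _ (\sum_k B j.+1 i1 k * m)).
  by rewrite -mulr_suml; apply: ler_wpM2r; [exact: normr_ge0|exact: Bsum].
rewrite -[leLHS]add0r lerD //; apply: ler_sum => k _; rewrite mulrCA.
have [<-|ik] := eqVneq i1 k; first by rewrite sE.
by rewrite ler_wnM2l // Boff.
Qed.

Lemma mesh_error_le (R : realType) (n N : nat) (t : nat -> R)
    (U : nat -> 'cV[R]_n) (u : R -> 'cV[R]_n) (c : R) :
  0 <= c -> (forall j k, (j <= N)%N -> `|U j k 0 - u (t j) k 0| <= c) ->
  mesh_error N t U u <= c.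
Proof.
move=> c0 Uc; apply: bigmax_le => // j _; apply: bigmax_le => // k _.
by apply: Uc; rewrite -ltnS.
Qed.

Theorem theorem5p6 (R : realType) (n : nat) (T alpha : R)
    (A : R -> 'M[R]_n) (f : R -> 'cV[R]_n) (u0 : 'cV[R]_n)
    (n_ge1 : (1 <= n)%N) (T_gt0 : 0 < T)
    (A_C1 : forall i j, C1_on T (fun t => A t i j))
    (f_C1 : forall i, C1_on T (fun t => f t i 0))
    (A_dom : forall (t : R) (i : 'I_n), t \in `[0, T] ->
       \sum_(j < n | j != i) `|A t i j| < A t i i)
    (A_offdiag : forall (t : R) (i j : 'I_n), t \in `[0, T] ->
       i != j -> A t i j <= 0)
    (alpha_gt0 : 0 < alpha)
    (alpha_lt : forall (t : R) (i : 'I_n), t \in `[0, T] ->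
       alpha < \sum_(j < n) A t i j) :
  exists C : R,
    forall (eps : 'rV[R]_n) (N : nat) (u : R -> 'cV[R]_n) (U : nat -> 'cV[R]_n),
      (forall i, 0 < eps 0 i <= 1) ->
      (forall i j : 'I_n, (i < j)%N -> eps 0 i < eps 0 j) ->
      2 * \big[Num.max/0]_(i < n) eps 0 i / alpha <= T ->
      (1 < N)%N -> (2 ^ n %| N)%N ->
      is_ivp_solution T eps A f u0 u ->
      is_euler_solution eps A f u0 N (shishkin_mesh T alpha eps N) U ->
      mesh_error N (shishkin_mesh T alpha eps N) U u <= C * N%:R^-1 * ln N%:R.
Proof.
have T0 := ltW T_gt0.
have /choice[dA' dAP] (p : 'I_n * 'I_n) := A_C1 p.1 p.2.
have /choice[df' dfP] i := f_C1 i.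
pose dA t : 'M[R]_n := \matrix_(i, j) dA' (i, j) t.
pose df t : 'cV[R]_n := \col_i df' i t.
have A_deriv i j t : t \in `[0, T] ->
    has_deriv_within `[0, T] (fun s => A s i j) t (dA t i j).
  by move=> tT; rewrite mxE; case: (dAP (i, j)) => + _; exact.
have f_deriv i t : t \in `[0, T] ->
    has_deriv_within `[0, T] (fun s => f s i 0) t (df t i 0).
  by move=> tT; rewrite mxE; case: (dfP i) => + _; exact.
have A_cont i j := has_deriv_within_itv_continuous (@A_deriv i j).
have f_cont i := has_deriv_within_itv_continuous (@f_deriv i).
have [a a0 A_le] := continuous_itv_bounded
  (g := fun p t => A t p.1 p.2) T0 (fun p => A_cont p.1 p.2).
have [F F0 f_le] := continuous_itv_bounded (g := fun i t => f t i 0) T0 f_cont.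
have [a1 a10 dA_le] := continuous_itv_bounded (g := dA') T0 (fun p => proj2 (dAP p)).
have [F1 F10 df_le] := continuous_itv_bounded (g := df') T0 (fun i => proj2 (dfP i)).
(* The spare room between [alpha] and the row sums, from which the supersolution draws its
   surplus. *)
have [gamma gamma0 A_sum] : exists2 gamma, 0 < gamma & forall i t,
    t \in `[0, T] -> gamma <= \sum_j A t i j - alpha.
  apply: continuous_itv_gt0 => // [i x|i t tT]; last by rewrite subr_gt0 alpha_lt.
  apply: cvgB; last exact: cvg_cst.
  by apply: cvg_big => [|j _]; [exact: add_continuous|exact: A_cont].
pose rate := flux_rate alpha gamma F F1 a a1 u0.
(* The two inner summands come from the mesh width and the [n] layer drops, and [alpha] from
   stability. Dividing by [ln 2] absorbs terms of order [1 / N], since [ln 2 <= ln N]. *)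
exists (rate * (2 ^+ n * T / ln 2 + n%:R * (1 / ln 2 + 2 ^+ n.+1)) / alpha).
move=> eps N u U eps01 eps_incr _ N1 dN [u_0 u_cont [du du_eq]] [U0 U_eq].
set t := shishkin_mesh T alpha eps N.
have eps0 i : 0 < eps 0 i by case/andP: (eps01 i).
have eps_ndec (i j : 'I_n) : (i <= j)%N -> eps 0 i <= eps 0 j.
  by rewrite leq_eqVlt => /predU1P[/val_inj->//|/eps_incr/ltW].
have row_eq (v w : 'cV[R]_n) (B : 'M[R]_n) i :
    (diag_mx eps *m v + B *m w) i 0 = eps 0 i * v i 0 + \sum_j B i j * w j 0.
  by rewrite mxE mul_diag_mx !mxE.
have rate0 : 0 <= rate by apply: flux_rate_ge0 => //; exact: ltW.
have ln2 : 0 < ln 2 :> R by rewrite ln_gt0 // ltr1n.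
have lnN : ln 2 <= ln N%:R :> R by rewrite ler_ln ?posrE ?ltr0n ?ler_nat // ltnW.
have N0 : 0 < N%:R :> R by rewrite ltr0n ltnW.
(* A bound on the truncation error valid on every mesh interval. *)
pose M := rate * (2 ^+ n * T * N%:R^-1
  + n%:R * ((1 + 2 ^+ n.+1 * ln N%:R) * N%:R^-1)).
have M_ge0 : 0 <= M.
  have := ltW N0; have := ltW (lt_le_trans ln2 lnN) => ? ?.
  by rewrite mulr_ge0 // addr_ge0 ?mulr_ge0 ?addr_ge0 ?mulr_ge0 ?exprn_ge0 ?invr_ge0.
have t_itv j : (j < N)%N -> t j.+1 \in `]0, T].
  move=> jN; rewrite in_itv /= mesh_le_T // andbT.
  by apply: le_lt_trans (mesh_lt T_gt0 alpha_gt0 eps0 N1 dN jN); exact: mesh_ge0.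
have t_itvc j : (j < N)%N -> t j.+1 \in `[0, T].
  by move=> /t_itv; rewrite !in_itv /= => /andP[/ltW -> ->].
have err j k : (j <= N)%N -> `|U j k 0 - u (t j) k 0| <= M / alpha.
  apply: (euler_stability (e := fun j k => U j k 0 - u (t j) k 0) (t := t)
    (B := fun j => A (t j)) (eps := fun i => eps 0 i)) => // {j k}.
  - by move=> i; exact: ltW.
  - by move=> j; exact: mesh_lt.
  - by move=> j i k jN; apply: A_offdiag; exact: t_itvc.
  - by move=> j i jN; apply: ltW; apply: alpha_lt; exact: t_itvc.
  - by move=> i; rewrite U0 u_0 subrr.
  - move=> j i jN.
    have Uj : eps 0 i * ((t j.+1 - t j)^-1 * (U j.+1 i 0 - U j i 0))
        + \sum_k A (t j.+1) i k * U j.+1 k 0 = f (t j.+1) i 0.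
      have /(congr1 (fun v : 'cV[R]_n => v i 0)) := U_eq j.+1 jN.
      by rewrite row_eq /backward_difference !mxE.
    (* By linearity the residual of [U - u] is minus the truncation error of [u]. *)
    have -> : eps 0 i * ((t j.+1 - t j)^-1 *
          (U j.+1 i 0 - u (t j.+1) i 0 - (U j i 0 - u (t j) i 0)))
        + \sum_k A (t j.+1) i k * (U j.+1 k 0 - u (t j.+1) k 0) =
        - (eps 0 i * ((t j.+1 - t j)^-1 * (u (t j.+1) i 0 - u (t j) i 0))
          + \sum_k A (t j.+1) i k * u (t j.+1) k 0 - f (t j.+1) i 0).
      under eq_bigr do rewrite mulrBr.
      by rewrite sumrB -Uj; ring.
    rewrite normrN.
    have := @truncation_error_le R n T alpha A dA f df T_gt0 A_deriv f_deriv
      A_offdiag alpha_gt0 gamma F F1 a a1 gamma0.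
    have As s k : s \in `[0, T] -> alpha + gamma <= \sum_j A s k j.
      by move=> sT; have := A_sum k s sT; lra.
    move=> /(_ As f_le).
    have df_le' k s : s \in `[0, T] -> `|df s k 0| <= F1.
      by move=> sT; rewrite mxE; exact: df_le.
    have dA_le' k l s : s \in `[0, T] -> `|dA s k l| <= a1.
      by move=> sT; rewrite mxE; exact: (dA_le (k, l)).
    move=> /(_ df_le' (fun k l => A_le (k, l)) dA_le' a0 (ltW F0) (ltW F10) (ltW a10)).
    move=> /(_ eps u0 u du eps0 eps_ndec u_0 u_cont) trunc.
    have {}trunc := trunc (fun k s sT => proj1 (du_eq s sT) k).
    apply: (le_trans (trunc _ i _ _ _ _ _)).
    + move=> k s sT; have [_ /(congr1 (fun v : 'cV[R]_n => v k 0))] := du_eq s sT.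
      by rewrite row_eq.
    + exact: mesh_ge0.
    + exact: mesh_lt.
    + exact: mesh_le_T.
    rewrite ler_wpM2l // lerD ?mesh_width_le //.
    rewrite mulr_natl -[X in _ *+ X]card_ord -sumr_const; apply: ler_sum => q _.
    exact: layer_drop_le.
apply: (@le_trans _ _ (M / alpha)).
  by apply: mesh_error_le => //; rewrite divr_ge0 // ltW.
have -> : rate * (2 ^+ n * T / ln 2 + n%:R * (1 / ln 2 + 2 ^+ n.+1)) / alpha
    * N%:R^-1 * ln N%:R =
  rate * (2 ^+ n * T * N%:R^-1 * (ln N%:R / ln 2)
    + n%:R * ((ln N%:R / ln 2 + 2 ^+ n.+1 * ln N%:R) * N%:R^-1)) / alpha by ring.
have r1 : 1 <= ln N%:R / ln 2 :> R by rewrite ler_pdivlMr // mul1r.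
rewrite ler_pM2r ?invr_gt0 // /M ler_wpM2l // lerD //.
  rewrite ler_peMr // !mulr_ge0 ?exprn_ge0 ?invr_ge0 //; exact: ltW.
by rewrite ler_wpM2l // ler_pM2r ?invr_gt0 // lerD2r.
Qed.
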